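(* Let $G=(V,E)$ and $G'=(V',E')$ be finite simple graphs with $V\cap V'=\emptyset$, and let $G\oplus_{v}G'$ be the vertex sum formed by identifying $u\in V$ and $u'\in V'$ into the vertex $v$. Suppose $S\subseteq V\setminus\{u\}$ and $S'\subseteq V'\setminus\{u'\}$ are maximal failed zero forcing sets of $G$ and $G'$, respectively. Then $S\cup S'$ is a failed zero forcing set of $G\oplus_{v}G'$. Moreover, $S\cup S'$ is a maximal failed zero forcing set of $G\oplus_{v}G'$ if and only if $S\cup S'\cup\{v\}$ is a zero forcing set of $G\oplus_{v}G'$.
   Context: The vertex sum $G\oplus_v G'$ has vertex set $(V\setminus\{u\})\cup(V'\setminus\{u'\})\cup\{v\}$; its edges are those of $G$ not incident to $u$, those of $G'$ not incident to $u'$, and the edges $\{v,w\}$ for $w\in N_G(u)\cup N_{G'}(u')$. Zero forcing: starting from an initial set $S$ of filled vertices, repeatedly apply the rule that a filled vertex $x$ forces (fills) a non-filled vertex $w$ if $w$ is the only non-filled neighbor of $x$, until no more forces are possible. $S$ is a zero forcing set if all vertices end up filled, otherwise a failed zero forcing set. A failed zero forcing set is maximal if it is not properly contained in another failed zero forcing set (equivalently, adding any vertex to it yields a zero forcing set). *)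

(* Defs.v *)
From mathcomp Require Import all_boot.

Set Implicit Arguments.
Unset Strict Implicit.
Unset Printing Implicit Defensive.

Record sgraph := SGraph {
  vertex :> finType;
  adj : rel vertex;
  adj_sym : symmetric adj;
  adj_irrefl : irreflexive adj
}.

Arguments adj {s} _ _.

Section ZeroForcing.
Variable G : sgraph.
Implicit Types (B S : {set G}) (x w : G).

Definition nbhd x : {set G} := [set y | adj x y].

Definition forces B x w :=
  [&& x \in B, w \notin B & nbhd x :\: B == [set w]].

Definition force_step : rel {set G} :=
  fun B B' => [exists x, exists w, forces B x w && (B' == w |: B)].

(* Forcing only adds vertices and a force stays available until its target is
   filled, so the final set does not depend on the order of the forces: all
   vertices end up filled iff some sequence of forces fills them all. *)
Definition zero_forcing S : bool := connect force_step S [set: G].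

Definition failed_zero_forcing S : bool := ~~ zero_forcing S.

Definition maximal_failed_zero_forcing S : bool :=
  maxset failed_zero_forcing S.

End ZeroForcing.

Section VertexSum.
Variables (G G' : sgraph) (u : G) (u' : G').

(* None is the new vertex v; Some (inl x) and Some (inr y) are the vertices of
   V \ {u} and of V' \ {u'}, which the sum type keeps disjoint. *)
Definition vsum_vertex : finType :=
  option ({x : G | x != u} + {y : G' | y != u'})%type.

Definition vsum_adj : rel vsum_vertex := fun a b =>
  match a, b with
  | Some (inl x), Some (inl y) => adj (val x) (val y)
  | Some (inr x), Some (inr y) => adj (val x) (val y)
  | None, Some (inl w) | Some (inl w), None => val w \in nbhd u
  | None, Some (inr w) | Some (inr w), None => val w \in nbhd u'
  | _, _ => false
  end.

Lemma vsum_adj_sym : symmetric vsum_adj.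
Proof. by move=> [[x|x]|] [[y|y]|] //=; rewrite adj_sym. Qed.

Lemma vsum_adj_irrefl : irreflexive vsum_adj.
Proof. by move=> [[x|x]|] //=; rewrite adj_irrefl. Qed.

Definition vertex_sum : sgraph := SGraph vsum_adj_sym vsum_adj_irrefl.

Definition vsum_v : vertex_sum := None.
Definition vsum_inl (x : {x : G | x != u}) : vertex_sum := Some (inl x).
Definition vsum_inr (y : {y : G' | y != u'}) : vertex_sum := Some (inr y).

(* The set S :|: S' in the vertex sum, meant for u \notin S and u' \notin S'. *)
Definition vsum_setU (S : {set G}) (S' : {set G'}) : {set vertex_sum} :=
  [set vsum_inl x | x in [set x | val x \in S]] :|:
  [set vsum_inr y | y in [set y | val y \in S']].

End VertexSum.

(* Main.v *)
Require Import Defs.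
From mathcomp Require Import all_boot.

(** A set is failed iff it lies in a proper stalled set (one from which no force
    is possible), so a maximal failed set is a maximal proper stalled set. Both
    [G] and [G'] embed in the vertex sum, and a vertex other than [u] or [u']
    keeps its whole neighborhood; hence a set avoiding [v] is stalled in the sum
    iff both its traces are. So [S :|: S'] is stalled, and a proper stalled set
    strictly above it must contain [v]: otherwise one of its traces would be a
    proper stalled set strictly above [S] or [S']. *)

Set Implicit Arguments.
Unset Strict Implicit.
Unset Printing Implicit Defensive.

(** * Stalled sets and maximal failed sets of a single graph *)

Section Stalled.
Variable G : sgraph.
Implicit Types (B S T : {set G}) (x w : G).

(** When [B] is proper, its complement is what is known as a fort. *)
Definition stalled B : bool := [forall x in B, #|nbhd x :\: B| != 1].

(** If [x] forced [w] outside [T], then [w] would also be the only neighbor of [x] outside the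
    larger set [T], so [T] would not be stalled. *)
Lemma force_step_sub T B B' :
  stalled T -> B \subset T -> force_step B B' -> B' \subset T.
Proof.
move=> /forall_inP stT sBT.
case/existsP=> x /existsP[w /andP[/and3P[xB wB /eqP Nw] /eqP->]].
rewrite subUset sBT andbT sub1set; apply: contraT => wT.
have /negP[] := stT x (subsetP sBT x xB).
suff -> : nbhd x :\: T = [set w] by rewrite cards1.
apply/eqP; rewrite eqEsubset -{1}Nw setDS //= sub1set inE wT /=.
by have := set11 w; rewrite -Nw => /setDP[].
Qed.

Lemma not_stalledP B :
  reflect (exists2 B', force_step B B' & B \proper B') (~~ stalled B).
Proof.
apply: (iffP idP) => [|[B' stepB ltB]].
  rewrite negb_forall_in => /exists_inP[x xB]; rewrite negbK => /cards1P[w Nw].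
  have wB : w \notin B by have := set11 w; rewrite -Nw => /setDP[].
  exists (w |: B); last by rewrite properUr // sub1set.
  apply/existsP; exists x; apply/existsP; exists w.
  by rewrite /forces xB wB Nw !eqxx.
apply/negP=> stB; have := force_step_sub stB (subxx B) stepB.
by rewrite (negPf (proper_subn ltB)).
Qed.

(** A stalled superset traps every sequence of forces. Conversely, forcing can go on until a stalled
    set is reached, and that set must be full. *)
Lemma zero_forcingP S :
  reflect (forall T, stalled T -> S \subset T -> T = [set: G]) (zero_forcing S).
Proof.
apply: (iffP idP) => [/connectP[p pathp lastp] T stT sST | zfS].
  apply/eqP; rewrite -subTset lastp.
  elim: p S pathp sST {lastp} => //= B p IH S /andP[stepS pathp] sST.
  exact: IH (force_step_sub stT sST stepS).
(* Induction on the number of unfilled vertices; the hypothesis passes to any superset of [S]. *)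
have [n] := ubnP #|~: S|; elim: n S zfS => // n IH S zfS.
rewrite ltnS => leSn.
have [stS|/not_stalledP[B stepS ltSB]] := boolP (stalled S).
  by rewrite (zfS S stS (subxx S)); apply: connect0.
apply: connect_trans (connect1 stepS) _; apply: IH => [T stT sBT|].
  exact: zfS stT (subset_trans (proper_sub ltSB) sBT).
by apply: leq_trans leSn; apply: proper_card; rewrite properE !setCS -properE.
Qed.

Lemma stalled_failed B : stalled B -> B != [set: G] -> failed_zero_forcing B.
Proof.
by move=> stB; apply: contra => /zero_forcingP/(_ B stB (subxx B))->.
Qed.

Lemma maximal_failedP S :
  reflect [/\ stalled S, S != [set: G]
            & forall T, stalled T -> S \proper T -> T = [set: G]]
          (maximal_failed_zero_forcing S).
Proof.
apply: (iffP maxsetP) => [[fS maxS] | [stS nST maxS]].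
  have nST : S != [set: G].
    by apply: contraNneq fS => ->; apply: connect0.
  split=> // [|T stT ltST].
    (* A force from [S] would lead to a strictly larger set, zero forcing by maximality, and [S]
       would be zero forcing too. *)
    apply: contraNT fS => /not_stalledP[B stepS ltSB].
    have zfB : zero_forcing B.
      apply: contraT => /maxS/(_ (proper_sub ltSB)) eqB.
      by rewrite eqB properxx in ltSB.
    exact: connect_trans (connect1 stepS) zfB.
  apply: contraTeq (ltST) => nT.
  by rewrite (maxS T (stalled_failed stT nT) (proper_sub ltST)) properxx.
split=> [|B fB sSB]; first exact: stalled_failed.
apply/eqP; rewrite eqEsubset sSB andbT; apply: contraR fB => nBS.
have ltSB : S \proper B by rewrite properE sSB.
by apply/zero_forcingP=> T stT /(proper_sub_trans ltSB)/maxS->.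
Qed.

End Stalled.

(** Transfers the count that decides stalling from [f x] to [x]: all neighbors of [f x] lie in the
    image of [f]. *)
Lemma card_nbhdD_preimset (G H : sgraph) (f : G -> H) (B : {set H}) (x : G) :
    injective f -> nbhd (f x) = f @: nbhd x ->
  #|nbhd (f x) :\: B| = #|nbhd x :\: f @^-1: B|.
Proof.
move=> injf ->; rewrite -(card_imset _ injf); apply: eq_card => z.
apply/setDP/imsetP=> [[/imsetP[y Ny ->] yB] | [y /setDP[Ny yB] ->]].
  by exists y; rewrite // in_setD Ny inE yB.
by split; [exact: imset_f | rewrite inE in yB].
Qed.

(** * Embeddings of the two graphs into the vertex sum *)

Section VertexSum.
Variables (G G' : sgraph) (u : G) (u' : G').
Notation H := (vertex_sum u u').
Notation v := (vsum_v u u').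
Implicit Types A B : {set H}.

(** [insub] fails only at [u], so the default value [v] performs the identification. *)
Definition vsum_embl (x : G) : H :=
  if insub x is Some y then vsum_inl u' y else v.
Definition vsum_embr (x : G') : H :=
  if insub x is Some y then vsum_inr u y else v.

Lemma vsum_embl_u : vsum_embl u = v.
Proof. by rewrite /vsum_embl insubF ?eqxx. Qed.

Lemma vsum_embr_u : vsum_embr u' = v.
Proof. by rewrite /vsum_embr insubF ?eqxx. Qed.

Lemma vsum_embl_val y : vsum_embl (val y) = vsum_inl u' y.
Proof. by rewrite /vsum_embl valK. Qed.

Lemma vsum_embr_val y : vsum_embr (val y) = vsum_inr u y.
Proof. by rewrite /vsum_embr valK. Qed.

Lemma vsum_embl_inj : injective vsum_embl.
Proof.
rewrite /vsum_embl => x y.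
case: insubP => [a _ <-|/negPn/eqP->]; case: insubP => [b _ <-|/negPn/eqP->] //.
by case=> ->.
Qed.

Lemma vsum_embr_inj : injective vsum_embr.
Proof.
rewrite /vsum_embr => x y.
case: insubP => [a _ <-|/negPn/eqP->]; case: insubP => [b _ <-|/negPn/eqP->] //.
by case=> ->.
Qed.

Lemma adj_vsum_embl x y :
  x != u -> adj (vsum_embl x) (vsum_embl y) = adj x y.
Proof.
move=> xu; rewrite /vsum_embl insubT.
by case: insubP => [b _ <-|/negPn/eqP->] //=; rewrite inE adj_sym.
Qed.

(** No edge joins the two sides directly; only [v] can have neighbors in both. *)
Lemma nbhd_vsum_embl x :
  x != u -> nbhd (vsum_embl x) = vsum_embl @: nbhd x.
Proof.
move=> xu; apply/setP=> z; rewrite inE; apply/idP/imsetP => [|[y + ->]].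
  case: z => [[y|y]|].
  - rewrite -[Some (inl y)]/(vsum_inl u' y) -vsum_embl_val.
    rewrite adj_vsum_embl // => xy.
    by exists (val y); rewrite // inE.
  - by rewrite /vsum_embl insubT.
  - rewrite -[None]/v -vsum_embl_u adj_vsum_embl // => xv.
    by exists u; rewrite // inE.
by rewrite inE adj_vsum_embl.
Qed.

Lemma adj_vsum_embr x y :
  x != u' -> adj (vsum_embr x) (vsum_embr y) = adj x y.
Proof.
move=> xu; rewrite /vsum_embr insubT.
by case: insubP => [b _ <-|/negPn/eqP->] //=; rewrite inE adj_sym.
Qed.

Lemma nbhd_vsum_embr x :
  x != u' -> nbhd (vsum_embr x) = vsum_embr @: nbhd x.
Proof.
move=> xu; apply/setP=> z; rewrite inE; apply/idP/imsetP => [|[y + ->]].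
  case: z => [[y|y]|].
  - by rewrite /vsum_embr insubT.
  - rewrite -[Some (inr y)]/(vsum_inr u y) -vsum_embr_val.
    rewrite adj_vsum_embr // => xy.
    by exists (val y); rewrite // inE.
  - rewrite -[None]/v -vsum_embr_u adj_vsum_embr // => xv.
    by exists u'; rewrite // inE.
by rewrite inE adj_vsum_embr.
Qed.

(** As [v] is not in [B], the traces avoid [u] and [u'], so each vertex of [B] is tested against its
    full neighborhood in its own graph. *)
Lemma stalled_vsum B : v \notin B ->
  stalled B = stalled (vsum_embl @^-1: B) && stalled (vsum_embr @^-1: B).
Proof.
move=> vB; apply/forall_inP/andP=> [stB | [/forall_inP stl /forall_inP str]].
  split; apply/forall_inP=> x; rewrite inE => xB.
    have xu : x != u.
      by apply: contraNneq vB => xu; rewrite xu vsum_embl_u in xB.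
    rewrite -card_nbhdD_preimset ?stB //; first exact: vsum_embl_inj.
    exact: nbhd_vsum_embl.
  have xu : x != u' by apply: contraNneq vB => xu; rewrite xu vsum_embr_u in xB.
  rewrite -card_nbhdD_preimset ?stB //; first exact: vsum_embr_inj.
  exact: nbhd_vsum_embr.
case=> [[y|y]|] xB; last by rewrite xB in vB.
- rewrite -[Some _]/(vsum_inl u' y) -vsum_embl_val in xB *.
  rewrite card_nbhdD_preimset; first by rewrite stl // inE.
    exact: vsum_embl_inj.
  exact/nbhd_vsum_embl/(valP y).
- rewrite -[Some _]/(vsum_inr u y) -vsum_embr_val in xB *.
  rewrite card_nbhdD_preimset; first by rewrite str // inE.
    exact: vsum_embr_inj.
  exact/nbhd_vsum_embr/(valP y).
Qed.

Lemma vsum_inl_setU (S : {set G}) (S' : {set G'}) y :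
  (vsum_inl u' y \in vsum_setU u u' S S') = (val y \in S).
Proof.
rewrite inE (mem_imset (f := @vsum_inl _ _ u u')) => [|a b [->] //].
by rewrite inE orbC; case: imsetP => // -[].
Qed.

Lemma vsum_inr_setU (S : {set G}) (S' : {set G'}) y :
  (vsum_inr u y \in vsum_setU u u' S S') = (val y \in S').
Proof.
rewrite inE orbC (mem_imset (f := @vsum_inr _ _ u u')) => [|a b [->] //].
by rewrite inE orbC; case: imsetP => // -[].
Qed.

Lemma vsum_v_setU (S : {set G}) (S' : {set G'}) : v \notin vsum_setU u u' S S'.
Proof. by rewrite inE negb_or; apply/andP; split; apply/imsetP=> -[]. Qed.

Lemma vsum_embl_setU (S : {set G}) (S' : {set G'}) :
  u \notin S -> vsum_embl @^-1: vsum_setU u u' S S' = S.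
Proof.
move=> uS; apply/setP=> x; rewrite inE /vsum_embl.
case: insubP => [y _ <-|/negPn/eqP->]; first exact: vsum_inl_setU.
by rewrite (negPf (vsum_v_setU _ _)) (negPf uS).
Qed.

Lemma vsum_embr_setU (S : {set G}) (S' : {set G'}) :
  u' \notin S' -> vsum_embr @^-1: vsum_setU u u' S S' = S'.
Proof.
move=> uS; apply/setP=> x; rewrite inE /vsum_embr.
case: insubP => [y _ <-|/negPn/eqP->]; first exact: vsum_inr_setU.
by rewrite (negPf (vsum_v_setU _ _)) (negPf uS).
Qed.

Lemma vsum_set_eq A B :
    vsum_embl @^-1: A = vsum_embl @^-1: B ->
    vsum_embr @^-1: A = vsum_embr @^-1: B ->
  A = B.
Proof.
move=> /setP eql /setP eqr; apply/setP=> -[[y|y]|].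
- by have := eql (val y); rewrite !inE vsum_embl_val.
- by have := eqr (val y); rewrite !inE vsum_embr_val.
- by have := eql u; rewrite !inE vsum_embl_u.
Qed.

End VertexSum.

Theorem theorem5p6 (G G' : sgraph) (u : G) (u' : G')
    (S : {set G}) (S' : {set G'})
    (hSu : S \subset [set~ u]) (hSu' : S' \subset [set~ u'])
    (hS : maximal_failed_zero_forcing S)
    (hS' : maximal_failed_zero_forcing S') :
  failed_zero_forcing (vsum_setU u u' S S') /\
  (maximal_failed_zero_forcing (vsum_setU u u' S S') <->
   zero_forcing (vsum_v u u' |: vsum_setU u u' S S')).
Proof.
have uS : u \notin S by rewrite subsetC sub1set inE in hSu.
have uS' : u' \notin S' by rewrite subsetC sub1set inE in hSu'.
have /maximal_failedP[stS _ maxS] := hS.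
have /maximal_failedP[stS' _ maxS'] := hS'.
have vU := vsum_v_setU u u' S S'.
set U := vsum_setU u u' S S' in vU *.
have Ul : @vsum_embl _ _ u u' @^-1: U = S by apply: vsum_embl_setU.
have Ur : @vsum_embr _ _ u u' @^-1: U = S' by apply: vsum_embr_setU.
have stU : stalled U by rewrite stalled_vsum // Ul Ur stS.
have nUT : U != [set: _] by apply: contraNneq vU => ->.
split; first exact: stalled_failed.
split=> [/maximal_failedP[_ _ maxU] | /zero_forcingP zfU].
  (* A stalled set containing [U] and [v] is strictly above [U], hence full. *)
  apply/zero_forcingP=> T stT sUT; apply: maxU => //.
  by apply: proper_sub_trans sUT; rewrite properUr // sub1set.
apply/maximal_failedP; split=> // T stT ltUT.
have [vT|vT] := boolP (vsum_v u u' \in T).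
  by apply: zfU; rewrite // subUset sub1set vT proper_sub.
move: stT; rewrite stalled_vsum // => /andP[stTl stTr].
(* A trace strictly above [S] would be all of [G] by maximality; it would contain [u], putting [v]
   in [T]. *)
have Tl : @vsum_embl _ _ u u' @^-1: T = S.
  apply/eqP; rewrite eq_sym; apply: contraNT vT => nST.
  have /(maxS _ stTl)/setP/(_ u) : S \proper @vsum_embl _ _ u u' @^-1: T.
    by rewrite properEneq nST -Ul preimsetS ?proper_sub.
  by rewrite !inE vsum_embl_u.
have Tr : @vsum_embr _ _ u u' @^-1: T = S'.
  apply/eqP; rewrite eq_sym; apply: contraNT vT => nST.
  have /(maxS' _ stTr)/setP/(_ u') : S' \proper @vsum_embr _ _ u u' @^-1: T.
    by rewrite properEneq nST -Ur preimsetS ?proper_sub.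
  by rewrite !inE vsum_embr_u.
have eqTU : T = U by apply: vsum_set_eq; rewrite ?Tl ?Tr ?Ul ?Ur.
by rewrite eqTU properxx in ltUT.
Qed.
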